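(* Let $d\ge 1$, let $\mathcal{M}_1,\dots,\mathcal{M}_d$ be reversible Markov chains on state spaces $\Sigma_1,\dots,\Sigma_d$ with stationary distributions $\pi_1,\dots,\pi_d$, let $\omega:\Sigma_1\times\dots\times\Sigma_d\to\mathbb{R}$ be a label function, let $k\ge 0$ be an integer and let $\varepsilon>0$. Suppose that $\sigma_0^1,\dots,\sigma_0^d$ are chosen independently with $\sigma_0^s\sim\pi_s$, and that $\xi_1,\dots,\xi_d$ are chosen uniformly and independently in $\{0,\dots,k\}$ (and independently of the $\sigma_0^s$). For each $s=1,\dots,d$, consider two independent trajectories $Y^s_0,Y^s_1,\dots$ and $Z^s_0,Z^s_1,\dots$ of $\mathcal{M}_s$ from $Y^s_0=Z^s_0=\sigma^s_0$, all trajectories for different $s$ being independent of each other and all trajectories being independent of the $\xi$'s. Write $\boldsymbol{\sigma}_0=(\sigma_0^1,\dots,\sigma_0^d)$, and let $\mathbf{Z}_{\boldsymbol{\sigma}_0,k}$ be the (random) collection of all $(k+1)^d$ vectors $(a_1,\dots,a_d)$ such that for each $i$, $a_i$ is one of the $k+1$ entries of the list $(\sigma_0^i,Y^i_1,\dots,Y^i_{\xi_i},Z^i_1,\dots,Z^i_{k-\xi_i})$. Then $$\Pr\big(\omega(\boldsymbol{\sigma}_0)\text{ is an }\varepsilon\text{-outlier among }\omega(\mathbf{x}),\ \mathbf{x}\in\mathbf{Z}_{\boldsymbol{\sigma}_0,k}\big)\le\varepsilon.$$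
   Context: Markov chains are time-homogeneous, discrete-time, on discrete (finite or countable) state spaces, specified by transition probabilities $P(\sigma,\tau)$. A trajectory of a chain is a sequence $X_0,X_1,X_2,\dots$ of random variables with $\Pr(X_i=\sigma_i\mid X_{i-1}=\sigma_{i-1},\dots,X_0=\sigma_0)=P(\sigma_{i-1},\sigma_i)$. A trajectory is $\pi$-stationary if $X_0\sim\pi$, where $\pi$ is a stationary distribution. A chain is reversible (with respect to $\pi$) if every $\pi$-stationary trajectory $X_0,\dots,X_n$ has the same distribution as its reverse $X_n,\dots,X_0$. A real number $a_0$ is an $\varepsilon$-outlier among a finite list $a_0,\dots,a_N$ if $\#\{i\in\{0,\dots,N\}: a_i\le a_0\}\le \varepsilon(N+1)$. The collection $\mathbf{Z}_{\boldsymbol{\sigma}_0,k}$ is indexed by the $(k+1)^d$ choices of list positions, so its elements are counted with multiplicity; the entry in which every coordinate is taken at the position of $\sigma_0^i$ is $\boldsymbol{\sigma}_0$. *)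

(* Defs.v *)
From HB Require Import structures.
From mathcomp Require Import all_boot all_order all_algebra.
From mathcomp Require Import all_classical all_reals all_analysis.
Set Implicit Arguments.
Unset Strict Implicit.
Unset Printing Implicit Defensive.
Import Order.TTheory GRing.Theory Num.Theory.
Local Open Scope classical_set_scope.
Local Open Scope ring_scope.

(* State spaces are countTypes, i.e. finite or countably infinite, carrying
   the discrete sigma-algebra. *)

Definition discrete_rv d (T : measurableType d) (S : Type) (X : T -> S) : Prop :=
  forall B : set S, measurable (X @^-1` B).

Definition sigma_rv (I T S : Type) (X : I -> T -> S) : set (set T) :=
  <<s [set A | exists i B, A = X i @^-1` B] >>.

(* Since x / 0 = 0, this is meaningful only when P B != 0; every use below is
   guarded by that condition. *)
Definition cond_prob d (T : measurableType d) (R : realType)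
    (P : probability T R) (A B : set T) : R :=
  fine (P (A `&` B)) / fine (P B).

Definition mutual_indep d (T : measurableType d) (R : realType)
    (P : probability T R) (I : finType) (G : I -> set (set T)) : Prop :=
  forall (J : {set I}) (A : I -> set T),
    (forall i, i \in J -> G i (A i)) ->
    P (\bigcap_(i in [set i | i \in J]) A i) = (\prod_(i in J) P (A i))%E.

Definition cond_indep d (T : measurableType d) (R : realType)
    (P : probability T R) (S : Type) (X : T -> S) (G H : set (set T)) : Prop :=
  forall (x : S) (A B : set T),
    P (X @^-1` [set x]) != 0%E -> G A -> H B ->
    cond_prob P (A `&` B) (X @^-1` [set x]) =
    cond_prob P A (X @^-1` [set x]) * cond_prob P B (X @^-1` [set x]).

Definition distribution_on (R : realType) (S : countType) (pi : S -> R) : Prop :=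
  (forall x, 0 <= pi x) /\ \esum_(x in [set: S]) (pi x)%:E = 1%E.

Definition transition_matrix (R : realType) (S : countType)
    (p : S -> S -> R) : Prop :=
  forall x, distribution_on (p x).

Definition stationary (R : realType) (S : countType)
    (p : S -> S -> R) (pi : S -> R) : Prop :=
  forall y, \esum_(x in [set: S]) (pi x * p x y)%:E = (pi y)%:E.

Definition has_law d (T : measurableType d) (R : realType)
    (P : probability T R) (S : Type) (X : T -> S) (pi : S -> R) : Prop :=
  forall x, P (X @^-1` [set x]) = (pi x)%:E.

(* X_0, ..., X_n is a trajectory; the values X_i for i > n are irrelevant. *)
Definition finite_trajectory d (T : measurableType d) (R : realType)
    (P : probability T R) (S : countType) (p : S -> S -> R) (n : nat)
    (X : nat -> T -> S) : Prop :=
  (forall i, (i <= n)%N -> discrete_rv (X i)) /\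
  forall (i : nat) (x : nat -> S), (i < n)%N ->
    let past := [set t | forall j, (j <= i)%N -> X j t = x j] in
    P past != 0%E ->
    cond_prob P (X i.+1 @^-1` [set x i.+1]) past = p (x i) (x i.+1).

Definition trajectory d (T : measurableType d) (R : realType)
    (P : probability T R) (S : countType) (p : S -> S -> R)
    (X : nat -> T -> S) : Prop :=
  forall n, finite_trajectory P p n X.

(* The sequence of states mkseq (X ^~ t) n.+1 = [:: X 0 t; ...; X n t] and its
   reverse have the same law, whatever the probability space carrying the
   stationary trajectory. *)
Definition reversible (R : realType) (S : countType)
    (p : S -> S -> R) (pi : S -> R) : Prop :=
  forall d (T : measurableType d) (P : probability T R) (n : nat)
         (X : nat -> T -> S),
    finite_trajectory P p n X -> has_law P (X 0%N) pi ->
    forall B : set (seq S),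
      P [set t | B (mkseq (X ^~ t) n.+1)] =
      P [set t | B (rev (mkseq (X ^~ t) n.+1))].

(* The list (x, y_1, ..., y_m, z_1, ..., z_(k-m)). *)
Definition splice (S : Type) (k m : nat) (x : S) (y z : nat -> S) : seq S :=
  x :: [seq y j | j <- iota 1 m] ++ [seq z j | j <- iota 1 (k - m)].

(* The vectors x with x_i an entry of the list l i, one for each choice c of
   positions in {0, ..., k}, hence counted with multiplicity.  The default x0
   of nth is never used when every l i has size k.+1. *)
Definition choice_vectors (d k : nat) (S : 'I_d -> Type)
    (x0 : forall i, S i) (l : forall i, seq (S i)) : seq (forall i, S i) :=
  [seq (fun i => nth (x0 i) (l i) (c i)) | c : {ffun 'I_d -> 'I_k.+1}].

(* a0 is assumed to be one of the entries of the list a, so that size a is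
   the number N + 1 of terms a_0, ..., a_N. *)
Definition outlier (R : realType) (eps a0 : R) (a : seq R) : Prop :=
  (count (fun b => b <= a0) a)%:R <= eps * (size a)%:R.

(* Main.v *)
(* Fix the values m of the xi's.  By reversibility the path
   (Y_m, ..., Y_1, sigma_0, Z_1, ..., Z_(k-m)) of each chain is a stationary
   trajectory of length k + 1, so its law does not depend on m, and sigma_0 is
   its entry of index m.  Hence, up to the order of its entries, the collection
   of vectors is the grid spanned by d stationary paths independent of the xi's,
   and sigma_0 is a uniformly random point of this grid.  For every choice of
   paths at most a fraction eps of the grid points are eps-outliers, because all
   outliers have labels at most the one with the largest label. *)
Require Import Defs.
From HB Require Import structures.
From mathcomp Require Import all_boot all_order all_algebra.
From mathcomp Require Import all_classical all_reals all_analysis.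
From mathcomp Require Import measurable_realfun ring.
Set Implicit Arguments.
Unset Strict Implicit.
Unset Printing Implicit Defensive.
Import Order.TTheory GRing.Theory Num.Theory.
Local Open Scope classical_set_scope.
Local Open Scope ring_scope.

(** * Counting outliers in a finite family *)

(** If there are outliers, let [i] be one with the largest label. Every outlier [j] has
    [f j <= f i], so the outliers are among the indices whose number is bounded because [i] is an
    outlier. *)
Lemma card_outliers (R : realType) (I : finType) (f : I -> R) (eps : R) :
  0 <= eps ->
  #|[pred i | #|[pred j | f j <= f i]|%:R <= eps * #|I|%:R]|%:R
    <= eps * #|I|%:R.
Proof.
move=> eps0; set out := [pred i | _].
case: (pickP out) => [i0 out_i0|out0]; last first.
  by rewrite (eq_card0 out0) mulr_ge0.
case: (Order.TotalTheory.arg_maxP f out_i0) => i out_i max_i.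
apply: le_trans out_i; rewrite ler_nat; apply/subset_leq_card/fintype.subsetP.
by move=> j out_j; rewrite !inE; exact: max_i.
Qed.

(** * Two-sided paths and the reordering of spliced lists *)

(* The path (y_m, ..., y_1, y_0 = z_0, z_1, ..., z_(k-m)) of k + 1 states. *)
Definition window (S : Type) (k m : nat) (y z : nat -> S) :
    {ffun 'I_k.+1 -> S} :=
  [ffun i : 'I_k.+1 => if (i <= m)%N then y (m - i)%N else z (i - m)%N].

(* [window k m y z] lists the entries of [splice k m x y z] in another order,
   obtained by reversing the positions 0, ..., m. *)
Definition flip (k : nat) (m c : 'I_k.+1) : 'I_k.+1 :=
  if (c <= m)%N then inord (m - c) else c.

Lemma flipE k (m c : 'I_k.+1) :
  flip m c = (if (c <= m)%N then m - c else c)%N :> nat.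
Proof.
rewrite /flip; case: ifP => // _.
by rewrite inordK // ltnS (leq_trans (leq_subr _ _)) // -ltnS.
Qed.

Lemma flipK k (m : 'I_k.+1) : involutive (flip m).
Proof.
move=> c; apply: val_inj; rewrite /= flipE flipE.
by case: (leqP c m) => [cm|mc]; rewrite ?leq_subr ?subKn // leqNgt mc.
Qed.

Lemma nth_splice (S : Type) k (m c : 'I_k.+1) (x0 x : S) y z :
  y 0%N = x -> nth x0 (splice k m x y z) c = window k m y z (flip m c).
Proof.
move=> y0; rewrite ffunE flipE.
case: (leqP c m) => [cm|mc]; last first.
  rewrite leqNgt mc /=; case: (nat_of_ord c) mc (ltn_ord c) => // n mn nk.
  rewrite /= nth_cat size_map size_iota ltnNge -ltnS mn /=.
  have nmk : (n - m < k - m)%N by rewrite ltn_sub2rE.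
  by rewrite (nth_map 0%N) ?size_iota // nth_iota // add1n subSn.
rewrite leq_subr subKn //; case: (nat_of_ord c) cm => [//|n nm] /=.
rewrite nth_cat size_map size_iota nm (nth_map 0%N) ?size_iota //.
by rewrite nth_iota // add1n.
Qed.

(** Applying [flip] in every coordinate is a bijection of the position choices, so splices and
    windows span the same vectors with the same multiplicities. The base point [x0] sits at position
    [m s] of each window. *)
Lemma outlier_window (R : realType) (d k : nat) (S : 'I_d -> Type)
    (omega : (forall s, S s) -> R) (eps : R) (m : 'I_d -> 'I_k.+1)
    (x0 : forall s, S s) (y z : forall s, nat -> S s)
    (w := fun s => window k (m s) (y s) (z s)) :
  (forall s, y s 0%N = x0 s) ->
  outlier eps (omega x0) [seq omega x | x <- choice_vectors k x0
    (fun s => splice k (m s) (x0 s) (y s) (z s))] <->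
  #|[pred c : {ffun 'I_d -> 'I_k.+1} |
     omega (fun s => w s (c s)) <= omega (fun s => w s (m s))]|%:R
  <= eps * #|{ffun 'I_d -> 'I_k.+1}|%:R.
Proof.
move=> y0.
have -> : omega (fun s => w s (m s)) = omega x0.
  apply: (congr1 omega); apply: functional_extensionality_dep => s.
  by rewrite ffunE leqnn subnn y0.
pose h (c : {ffun 'I_d -> 'I_k.+1}) := [ffun s => flip (m s) (c s)].
have hK : involutive h by move=> c; apply/ffunP => s; rewrite !ffunE flipK.
rewrite /outlier size_map size_map -cardE.
set n1 := count _ _; set n2 := (X in _ <-> X%:R <= _).
suff -> : n1 = n2 by split.
rewrite /n1 /n2 -sum1_count big_map big_image_cond /= -sum1_card.
rewrite (reindex_inj (inv_inj hK)) /=; apply: eq_bigl => c.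
rewrite !inE; congr (_ <= _); apply: (congr1 omega).
apply: functional_extensionality_dep => s.
by rewrite nth_splice // [h c s]ffunE flipK.
Qed.

(** * Measurability of events of processes with countable state space *)

Lemma discrete_rv_points d (T : measurableType d) (S : countType) (X : T -> S) :
  (forall x, measurable (X @^-1` [set x])) -> discrete_rv X.
Proof.
move=> mX B.
have -> : X @^-1` B = \bigcup_(x : S)
    (if x \in B then X @^-1` [set x] else set0).
  apply/seteqP; split => [t Bt|t [x _]].
    by exists (X t) => //; rewrite mem_set.
  by case: ifPn => // /set_mem Bx /= Xtx; rewrite Xtx.
apply: countable_bigcupT_measurable => // x.
by case: ifP => // _; exact: measurable0.
Qed.

Section SigmaAlgebra.
Context (T : Type) (G : set (set T)) (sG : sigma_algebra setT G).

(** A countable intersection is the complement of a countable union of complements. [G] is kept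
    arbitrary to cover both the measurable sets and the sigma-algebras [sigma_rv X]. *)
Lemma sigma_algebra_forall (J : countType) (Q : J -> T -> Prop) :
  (forall j, G [set t | Q j t]) -> G [set t | forall j, Q j t].
Proof.
case: sG => G0 GC GU GQ.
pose F n := if unpickle n is Some j then setT `\` [set t | Q j t] else set0.
rewrite (_ : [set t | _] = setT `\` \bigcup_n F n).
  by apply/GC/GU => n; rewrite /F; case: unpickle => // j; exact: GC.
apply/seteqP; split => [t Qt|t [_ nQ] j].
  split => // -[n _]; rewrite /F; case: unpickle => // j [_].
  by apply; exact: Qt.
apply: contrapT => nQj; apply: nQ; exists (pickle j) => //.
by rewrite /F pickleK; split.
Qed.

Lemma sigma_algebraT : G setT.
Proof. by case: sG => G0 GC _; rewrite -(setD0 setT); exact: GC. Qed.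

Lemma sigma_algebra_past (S : Type) (X : nat -> T -> S) (x : nat -> S) n :
  (forall i B, G (X i @^-1` B)) ->
  G [set t | forall j, (j <= n)%N -> X j t = x j].
Proof.
move=> GX; apply: sigma_algebra_forall => j; case: leqP => [jn|nj].
  rewrite (_ : [set t | _] = X j @^-1` [set x j]); first exact: GX.
  by apply/seteqP; split => t /= => [->|].
rewrite (_ : [set t | _] = setT); first exact: sigma_algebraT.
by apply/seteqP; split.
Qed.

Lemma sigma_algebra_window (S : Type) (y z : nat -> T -> S) k m
    (v : {ffun 'I_k.+1 -> S}) :
  (forall n B, G (y n @^-1` B)) -> (forall n B, G (z n @^-1` B)) ->
  G [set t | window k m (y ^~ t) (z ^~ t) = v].
Proof.
move=> Gy Gz.
rewrite (_ : [set t | _] =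
    [set t | forall i, window k m (y ^~ t) (z ^~ t) i = v i]).
  apply: sigma_algebra_forall => i; under eq_set do rewrite ffunE.
  by case: (leqP i m) => _; [exact: (Gy _ [set v i])|exact: (Gz _ [set v i])].
by apply/seteqP; split => t /= => [->//|E]; exact/ffunP.
Qed.

End SigmaAlgebra.

Lemma sigma_algebra_rv (I T S : Type) (X : I -> T -> S) :
  sigma_algebra setT (sigma_rv X).
Proof. exact: smallest_sigma_algebra. Qed.

Lemma sigma_rv_preimage (I T S : Type) (X : I -> T -> S) i B :
  sigma_rv X (X i @^-1` B).
Proof. by apply: sub_gen_smallest; exists i, B. Qed.

Lemma sigma_rv_past (T S : Type) (X : nat -> T -> S) (x : nat -> S) n :
  sigma_rv X [set t | forall j, (j <= n)%N -> X j t = x j].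
Proof.
apply: (sigma_algebra_past (sigma_algebra_rv X)); exact: sigma_rv_preimage.
Qed.

(** * Laws of variables with countably many values *)

Section Law.
Context d (T : measurableType d) (R : realType) (P : probability T R).

(** Countable additivity passes from points to sets. In the application [D] fixes the values of the
    xi's and [c] is its probability. *)
Lemma discrete_law_scale (S : countType) (X X' : T -> S) (D : set T) (c : R) :
  measurable D -> discrete_rv X -> discrete_rv X' ->
  (forall x, P (D `&` X @^-1` [set x]) = (c%:E * P (X' @^-1` [set x]))%E) ->
  forall B, P (D `&` X @^-1` B) = (c%:E * P (X' @^-1` B))%E.
Proof.
move=> mD mX mX' XX' B.
(* Codes are injective, so each piece is the fibre of a single point of [B] or is empty. *)
pose pt (Y : T -> S) n := Y @^-1` (B `&` [set x | pickle x = n]).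
have split_pt (Y : T -> S) : Y @^-1` B = \bigcup_n pt Y n.
  apply/seteqP; split => [t Bt|t [n _ [Bt _]]//].
  by exists (pickle (Y t)) => //; split.
have disj Y : trivIset setT (pt Y).
  by move=> n n' _ _ [t [[_ /= tn] [_ /= tn']]]; rewrite -tn -tn'.
rewrite !split_pt setI_bigcupr !measure_bigcup //; last first.
- exact: trivIset_setIl.
- by move=> n _; apply: measurableI => //; exact: mX.
- by move=> n _; exact: mX'.
rewrite -nneseriesZl => [|n _]; last exact: measure_ge0.
apply: eq_eseriesr => n _.
have [[x [Bx xn]]|nex] := pselect (exists x, B x /\ pickle x = n).
  have ptE Y : pt Y n = Y @^-1` [set x].
    rewrite /pt; apply/seteqP; split => t /= => [[_ tn]|->//].
    by apply: (pcan_inj pickleK); rewrite tn.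
  by rewrite !ptE; exact: XX'.
have ptE Y : pt Y n = set0.
  by rewrite -subset0 => t [Bt tn]; apply: nex; exists (Y t).
by rewrite !ptE setI0 !measure0 mule0.
Qed.

End Law.

(** * Path probabilities and detailed balance *)

Section Chain.
Context d (T : measurableType d) (R : realType) (P : probability T R).
Context (S : countType) (p : S -> S -> R) (pi : S -> R).

Lemma measurable_past (X : nat -> T -> S) (x : nat -> S) n :
  trajectory P p X -> measurable [set t | forall j, (j <= n)%N -> X j t = x j].
Proof.
move=> tX; apply: (sigma_algebra_past (sigma_algebra_measurable T)) => i B.
exact: (tX i).1.
Qed.

Lemma trajectory_prob (X : nat -> T -> S) (x : nat -> S) n :
  trajectory P p X -> has_law P (X 0%N) pi ->
  P [set t | forall j, (j <= n)%N -> X j t = x j] =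
  (pi (x 0%N) * \prod_(0 <= j < n) p (x j) (x j.+1))%:E.
Proof.
move=> tX lX; elim: n => [|n IHn].
  rewrite big_geq // mulr1 -lX; congr (P _).
  by apply/seteqP; split => t /= => [->//|xt [|j]].
set past := [set t | _] in IHn *; set A := X n.+1 @^-1` [set x n.+1].
have mA : measurable A by exact: (tX n.+1).1.
have mpast : measurable past by exact: measurable_past tX.
have -> : [set t | forall j, (j <= n.+1)%N -> X j t = x j] = A `&` past.
  apply/seteqP; split => t /=.
    by move=> Xt; split => [|j jn]; apply: Xt => //; exact: leqW.
  by move=> [At pt] j; rewrite leq_eqVlt => /predU1P[->//|]; exact: pt.
rewrite big_nat_recr //= mulrA.
(* A null past leaves the conditional probability unspecified, but then both sides vanish, the right
   one by the induction hypothesis. *)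
have [P0|P0] := eqVneq (P past) 0%E.
  rewrite (subset_measure0 _ mpast (@subIsetr _ A past)) //; last first.
    exact: measurableI.
  by rewrite P0 in IHn; case: IHn => <-; rewrite mul0r.
have := (tX n.+1).2 n x (ltnSn n) P0; rewrite /cond_prob -/past -/A => pE.
have fP B : measurable B -> P B \is a fin_num by exact: fin_num_measure.
rewrite -[LHS]fineK ?fP //; last exact: measurableI.
congr EFin; rewrite -pE mulrC.
have := congr1 fine IHn => /= <-; rewrite divfK // fine_eq0 ?fP //.
Qed.

(** Reversibility is applied to the pair of the first two states; [X] supplies the stationary
    trajectory over which it quantifies. *)
Lemma reversible_detailed_balance (X : nat -> T -> S) :
  trajectory P p X -> has_law P (X 0%N) pi -> reversible p pi ->
  forall a b, pi a * p a b = pi b * p b a.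
Proof.
move=> tX lX rev_p a b.
have pairE u v : P [set t | mkseq (X ^~ t) 2 = [:: u; v]] = (pi u * p u v)%:E.
  pose x j := if j is 0%N then u else v.
  have := trajectory_prob x 1 tX lX; rewrite big_nat1 /= => <-; congr (P _).
  apply/seteqP; split => t /=; first by case=> X0 X1 [|[|]].
  by move=> Xt; rewrite /mkseq /= !Xt.
have := rev_p _ _ _ _ _ (tX 1%N) lX [set [:: a; b]]; rewrite /= pairE => revE.
apply: EFin_inj; rewrite revE -pairE; congr (P _).
by apply/seteqP; split => t;
  rewrite /= /rev /mkseq /= => -[e0 e1]; rewrite e0 e1.
Qed.

(** Detailed balance moves the weight [pi] along the path one edge at a time, reversing each edge
    that it crosses. *)
Lemma detailed_balance_path (x : nat -> S) m :
  (forall a b, pi a * p a b = pi b * p b a) ->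
  pi (x m) * \prod_(0 <= j < m) p (x (m - j)%N) (x (m - j.+1)%N) =
  pi (x 0%N) * \prod_(0 <= j < m) p (x j) (x j.+1).
Proof.
move=> db; elim: m => [|m IHm]; first by rewrite !big_geq.
rewrite big_nat_recl // big_nat_recr //= subn0 subSS subn0 mulrA db mulrAC.
by rewrite [RHS]mulrA -IHm.
Qed.

(** * Gluing two trajectories at their common start *)

Section Splicing.
Context (Y Z : nat -> T -> S).
Hypotheses (tY : trajectory P p Y) (tZ : trajectory P p Z).
Hypotheses (lY : has_law P (Y 0%N) pi) (YZ0 : forall t, Z 0%N t = Y 0%N t).
Hypothesis YZ : cond_indep P (Y 0%N) (sigma_rv Y) (sigma_rv Z).

(** Given the start, the two pieces are independent. When [pi (y 0)] is nonzero, the joint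
    probability is thus the product of the two path probabilities divided once by [pi (y 0)]. *)
Lemma two_sided_prob (y z : nat -> S) m n : y 0%N = z 0%N ->
  P ([set t | forall j, (j <= m)%N -> Y j t = y j] `&`
     [set t | forall j, (j <= n)%N -> Z j t = z j]) =
  (pi (y 0%N) * (\prod_(0 <= j < m) p (y j) (y j.+1)) *
     (\prod_(0 <= j < n) p (z j) (z j.+1)))%:E.
Proof.
move=> yz0; set A := [set t | _]; set B := [set t | _].
have mA : measurable A by exact: measurable_past tY.
have mB : measurable B by exact: measurable_past tZ.
have lZ : has_law P (Z 0%N) pi.
  by move=> a; rewrite (_ : Z 0%N = Y 0%N) //; apply/funext.
set C := Y 0%N @^-1` [set y 0%N].
have mC : measurable C by exact: (tY 0%N).1.
(* Both events lie in [C], so intersecting them with the conditioning event changes neither. *)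
have AC : A `<=` C by move=> t At; exact: At.
have BC : B `<=` C by move=> t Bt; rewrite /C /= -YZ0 yz0; exact: Bt.
have PA := trajectory_prob y m tY lY; have PB := trajectory_prob z n tZ lZ.
rewrite -/A in PA; rewrite -/B -yz0 in PB.
have PC : P C = (pi (y 0%N))%:E by exact: lY.
have [C0|C0] := eqVneq (P C) 0%E.
  rewrite (@subset_measure0 _ _ _ P _ C) //; last 2 first.
  - exact: measurableI.
  - by move=> t [/AC].
  by rewrite C0 in PC; case: PC => <-; rewrite !mul0r.
have := YZ C0 (sigma_rv_past y m) (sigma_rv_past z n).
rewrite -/A -/B /cond_prob (setIidl AC) (setIidl BC) setIidl; last first.
  by move=> t [/AC].
rewrite PA PB PC /= => ABE.
have pi0 : pi (y 0%N) != 0 by apply: contraNneq C0; rewrite PC => ->.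
rewrite -[LHS]fineK; last by apply: fin_num_measure; exact: measurableI.
congr EFin; apply: (mulIf (invr_neq0 pi0)); rewrite ABE.
by field.
Qed.

(** Detailed balance turns the [Y] half around, so the glued path is distributed as a stationary
    trajectory started at its left end, whatever [m] is. *)
Lemma window_prob k m (v : {ffun 'I_k.+1 -> S}) :
  (forall a b, pi a * p a b = pi b * p b a) -> (m <= k)%N ->
  P [set t | window k m (Y ^~ t) (Z ^~ t) = v] =
  (pi (v ord0) * \prod_(0 <= j < k) p (v (inord j)) (v (inord j.+1)))%:E.
Proof.
move=> db mk; pose x j := v (inord j).
(* From the centre [x m], [Y] runs down to [x 0] and [Z] up to [x k]. *)
have := @two_sided_prob (fun j => x (m - j)%N) (fun j => x (m + j)%N) m (k - m).
rewrite subn0 addn0 => /(_ erefl) PE.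
have -> : v ord0 = x 0%N by congr (v _); apply: val_inj; rewrite /= inordK.
rewrite (big_cat_nat (n := m)) //= mulrA -detailed_balance_path //.
rewrite -[X in _ * \prod_(X <= _ < _) _]add0n big_addn.
under [X in _ * X]eq_bigr => j _ do rewrite addnC -addnS.
rewrite -PE; congr (P _); apply/seteqP; split => t /=.
  move=> wv; rewrite /x -wv; split => j jm; rewrite ffunE inordK.
  - by rewrite leq_subr subKn.
  - by rewrite ltnS (leq_trans (leq_subr _ _)).
  (* [window] reads its centre from [Y], so the case [j = 0] rests on the common start. *)
  - case: leqP => [|_]; last by rewrite addKn.
    rewrite -{2}[m]addn0 leq_add2l leqn0 => /eqP ->.
    by rewrite addn0 subnn YZ0.
  - by rewrite ltnS -leq_subRL.
move=> [Yx Zx]; apply/ffunP => i; rewrite ffunE.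
have ik := ltn_ord i.
case: leqP => im.
  by rewrite Yx ?leq_subr // subKn // /x inord_val.
rewrite Zx; last by rewrite leq_sub2r.
by rewrite subnKC ?(ltnW im) // /x inord_val.
Qed.

End Splicing.
End Chain.

(** * Expected counts, and independence of positions and paths *)

(** The sum is the expected number of events that occur, and this number is at most [c] at every
    point. *)
Lemma sum_prob_le d (T : measurableType d) (R : realType) (P : probability T R)
    (I : finType) (B : I -> set T) (c : R) :
  (forall i, measurable (B i)) -> (forall t, #|[pred i | t \in B i]|%:R <= c) ->
  (\sum_i P (B i) <= c%:E)%E.
Proof.
move=> mB cB.
have mI i : measurable_fun setT (EFin \o \1_(B i) : T -> \bar R).
  exact/measurable_EFinP/measurable_indic.
under eq_bigr => i _ do rewrite -(setIT (B i)) -integral_indic //.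
rewrite -ge0_integral_sum //.
have <- : (\int[P]_x cst c%:E x)%E = c%:E.
  by rewrite integral_cst // [X in (_ * X)%E]probability_setT mule1.
apply: ge0_le_integral => //.
- by move=> t _; apply: sume_ge0 => i _; rewrite lee_fin.
- exact: emeasurable_sum.
- move=> t _; rewrite sumEFin lee_fin; apply: le_trans (cB t).
  rewrite -sum1_card natr_sum [leRHS]big_mkcond /=.
  by apply: ler_sum => i _; rewrite indicE inE; case: (t \in B i).
Qed.

(** Independence splits off the uniform laws of the xi's, and by [window_prob] the remaining window
    laws do not depend on the positions; position [ord0] serves as reference. *)
Lemma prob_windows (R : realType) (d : nat) (S : 'I_d -> countType)
  (p : forall s : 'I_d, S s -> S s -> R) (pi : forall s : 'I_d, S s -> R)
  (hrev : forall s, reversible (p s) (pi s)) (k : nat)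
  (disp : measure_display) (T : measurableType disp) (P : probability T R)
  (xi : 'I_d -> T -> 'I_k.+1) (Y Z : forall s : 'I_d, nat -> T -> S s)
  (hY_law : forall s, has_law P (Y s 0%N) (pi s))
  (hxi : forall s, has_law P (xi s) (fun _ => (k.+1)%:R^-1))
  (hY : forall s, trajectory P (p s) (Y s))
  (hZ : forall s, trajectory P (p s) (Z s))
  (hYZ0 : forall s t, Z s 0%N t = Y s 0%N t)
  (hYZ : forall s, cond_indep P (Y s 0%N) (sigma_rv (Y s)) (sigma_rv (Z s)))
  (hindep : mutual_indep P (fun i : 'I_d + 'I_d =>
     match i with
     | inl s => sigma_rv (fun n t => (Y s n t, Z s n t))
     | inr s => sigma_rv (fun (_ : unit) t => xi s t)
     end))
  (m : {ffun 'I_d -> 'I_k.+1}) (v : forall s, {ffun 'I_k.+1 -> S s}) :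
  let W (m' : 'I_d -> 'I_k.+1) :=
    [set t | forall s, window k (m' s) (Y s ^~ t) (Z s ^~ t) = v s] in
  P ([set t | forall s, xi s t = m s] `&` W m) =
  ((#|{ffun 'I_d -> 'I_k.+1}|%:R^-1)%:E * P (W (fun=> ord0)))%E.
Proof.
move=> W.
pose Ws (m' : 'I_d -> 'I_k.+1) s :=
  [set t | window k (m' s) (Y s ^~ t) (Z s ^~ t) = v s].
(* The pairs generate the sigma-algebras of [hindep], which contain the window events. *)
pose X s n t := (Y s n t, Z s n t).
have sWs m' s : sigma_rv (X s) (Ws m' s).
  apply: (sigma_algebra_window (sigma_algebra_rv (X s))) => n B.
    exact: (@sigma_rv_preimage _ _ _ (X s) n [set q | B q.1]).
  exact: (@sigma_rv_preimage _ _ _ (X s) n [set q | B q.2]).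
have PWs m' s : P (Ws m' s) = P (Ws (fun=> ord0) s).
  have db := reversible_detailed_balance (hY s) (hY_law s) (hrev s).
  have wE := window_prob (hY s) (hZ s) (hY_law s) (hYZ0 s) (hYZ s) _ db.
  by rewrite !wE // -ltnS.
pose C m' (D : 'I_d -> set T) (i : 'I_d + 'I_d) :=
  match i with inl s => Ws m' s | inr s => D s end.
(* [D] is left free: fixing the xi's gives the left side of the goal, and taking [setT] gives the
   reference probability. *)
have indepC m' D : (forall s, sigma_rv (fun _ : unit => xi s) (D s)) ->
    P ([set t | forall s, D s t] `&` W m') =
    ((\prod_s P (Ws (fun=> ord0) s)) * \prod_s P (D s))%E.
  move=> sD.
  have := hindep [set: 'I_d + 'I_d]%SET (C m' D).
  rewrite big_sumType /=.
  under eq_bigl do rewrite finset.in_setT.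
  under [X in (_ * X)%E]eq_bigl do rewrite finset.in_setT.
  under eq_bigr do rewrite PWs.
  move=> <-; last by case=> s _ /=.
  congr (P _); apply/seteqP; split => t /=.
    by move=> [Dt Wt] [s|s] _ /=; [exact: Wt|exact: Dt].
  by move=> Ct; split => s; [apply: (Ct (inr s))|apply: (Ct (inl s))];
    rewrite /= finset.in_setT.
have -> : [set t | forall s, xi s t = m s] =
    [set t | forall s, (xi s @^-1` [set m s]) t] by [].
rewrite indepC; last first.
  by move=> s; exact: (@sigma_rv_preimage _ _ _ (fun=> xi s) tt).
rewrite -[W (fun=> ord0)]setTI.
have -> : [set: T] = [set t | forall s : 'I_d, [set: T] t].
  by apply/seteqP; split.
rewrite (indepC _ (fun=> setT)); last first.
  by move=> s; exact: (sigma_algebraT (sigma_algebra_rv (fun=> xi s))).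
under [X in _ = (_ * (_ * X))%E]eq_bigr do rewrite probability_setT.
rewrite big1_eq mule1 muleC; congr (_ * _)%E.
under eq_bigr do rewrite hxi.
rewrite prodEFin prodr_const card_ffun !card_ord.
by rewrite natrX exprVn.
Qed.

(** * The bound on the outlier probability *)

Theorem theorem7p1 (R : realType) (d : nat) (hd : (1 <= d)%N)
  (S : 'I_d -> countType)
  (p : forall s : 'I_d, S s -> S s -> R) (pi : forall s : 'I_d, S s -> R)
  (hp : forall s, transition_matrix (p s))
  (hpi : forall s, distribution_on (pi s))
  (hstat : forall s, stationary (p s) (pi s))
  (hrev : forall s, reversible (p s) (pi s))
  (omega : (forall s : 'I_d, S s) -> R) (k : nat) (eps : R) (heps : 0 < eps)
  (disp : measure_display) (T : measurableType disp) (P : probability T R)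
  (sigma0 : forall s : 'I_d, T -> S s) (xi : 'I_d -> T -> 'I_k.+1)
  (Y Z : forall s : 'I_d, nat -> T -> S s)
  (hsigma0 : forall s, has_law P (sigma0 s) (pi s))
  (hxi_rv : forall s, discrete_rv (xi s))
  (hxi : forall s, has_law P (xi s) (fun _ => (k.+1)%:R^-1))
  (hY : forall s, trajectory P (p s) (Y s))
  (hZ : forall s, trajectory P (p s) (Z s))
  (hY0 : forall s t, Y s 0%N t = sigma0 s t)
  (hZ0 : forall s t, Z s 0%N t = sigma0 s t)
  (hYZ : forall s, cond_indep P (sigma0 s) (sigma_rv (Y s)) (sigma_rv (Z s)))
  (hindep : mutual_indep P (fun i : 'I_d + 'I_d =>
     match i with
     | inl s => sigma_rv (fun n t => (Y s n t, Z s n t))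
     | inr s => sigma_rv (fun (_ : unit) t => xi s t)
     end)) :
  (P [set t |
      let x0 := fun s => sigma0 s t in
      outlier eps (omega x0)
        [seq omega x | x <- choice_vectors k x0 (fun s =>
           splice k (xi s t) (sigma0 s t) (fun n => Y s n t)
             (fun n => Z s n t))]]
   <= eps%:E)%E.
Proof.
have Y0E s : Y s 0%N = sigma0 s by exact/funext.
pose N : R := #|{ffun 'I_d -> 'I_k.+1}|%:R.
have N0 : 0 < N by rewrite ltr0n card_ffun !card_ord expn_gt0.
(* A finite dependent function makes the family of windows one variable with values in a countable
   type, as [discrete_law_scale] requires. *)
pose V (m : 'I_d -> 'I_k.+1) t : {dffun forall s, {ffun 'I_k.+1 -> S s}} :=
  [ffun s => window k (m s) (Y s ^~ t) (Z s ^~ t)].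
pose out (m : {ffun 'I_d -> 'I_k.+1})
    (v : {dffun forall s, {ffun 'I_k.+1 -> S s}}) :=
  #|[pred c : {ffun 'I_d -> 'I_k.+1} |
     omega (fun s => v s (c s)) <= omega (fun s => v s (m s))]|%:R <= eps * N.
pose Xi (m : {ffun 'I_d -> 'I_k.+1}) := [set t | forall s, xi s t = m s].
have mXi m : measurable (Xi m).
  apply: (sigma_algebra_forall (sigma_algebra_measurable T)) => s.
  exact: (hxi_rv s [set m s]).
have VE m v : V m @^-1` [set v] =
    [set t | forall s, window k (m s) (Y s ^~ t) (Z s ^~ t) = v s].
  apply/seteqP; split => t /= => [<- s|E]; first by rewrite ffunE.
  by apply/ffunP => s; rewrite ffunE E.
have mV m : discrete_rv (V m).
  apply: discrete_rv_points => v; rewrite VE.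
  apply: (sigma_algebra_forall (sigma_algebra_measurable T)) => s.
  apply: (sigma_algebra_window (sigma_algebra_measurable T)) => n B.
    exact: (hY s n).1.
  exact: (hZ s n).1.
set E := [set t | _].
(* The event is split by the value [m] of the xi's; on each piece it depends only on [m] and
   [V m]. *)
have EE : E = \bigcup_(m : {ffun 'I_d -> 'I_k.+1})
    (Xi m `&` V m @^-1` [set v | out m v]).
  have EVE t : E t <-> out [ffun s => xi s t] (V (fun s => xi s t) t).
    rewrite /E /= outlier_window //; rewrite /out.
    have VtE (c : 'I_d -> 'I_k.+1) :
        (fun s => V (fun s => xi s t) t s (c s)) =
        fun s => window k (xi s t) (Y s ^~ t) (Z s ^~ t) (c s).
      by apply: functional_extensionality_dep => s; rewrite [V _ _ _]ffunE.
    set n1 := #|_|; set n2 := (X in _ <-> X%:R <= _).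
    suff -> : n1 = n2 by split.
    have xiE : [ffun s => xi s t] =1 (xi ^~ t) by move=> s; rewrite ffunE.
    by apply: eq_card => c; rewrite !inE !VtE (funext xiE).
  apply/seteqP; split => t.
    move=> /EVE outt; exists [ffun s => xi s t] => //; split.
      by move=> s /=; rewrite ffunE.
    rewrite /= (_ : V [ffun s => xi s t] t = V (fun s => xi s t) t) //.
    by apply/ffunP => s; rewrite !ffunE.
  move=> [m _ [xim outt]]; apply/EVE.
  have -> : [ffun s => xi s t] = m by apply/ffunP => s; rewrite ffunE xim.
  have -> : (fun s => xi s t) = m by apply/funext => s; rewrite xim.
  exact: outt.
(* With the reference windows in place of [V m], all events [B m] concern the same random grid; only
   the marked point [m] varies. *)
pose B m := V (fun=> ord0) @^-1` [set v | out m v].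
have PB m : P (Xi m `&` V m @^-1` [set v | out m v]) = (N^-1%:E * P (B m))%E.
  apply: discrete_law_scale => // v; rewrite !VE.
  apply: (prob_windows hrev) => // s.
  - by rewrite Y0E.
  - by move=> t; rewrite hY0 hZ0.
  - by rewrite Y0E.
have mE m : measurable (Xi m `&` V m @^-1` [set v | out m v]).
  by apply: measurableI => //; exact: mV.
rewrite EE measure_fin_bigcup //; last 2 first.
- exact: finite_finset.
- move=> m m' _ _ [t [[xm _] [xm' _]]].
  by apply/ffunP => s; rewrite -xm -xm'.
rewrite (fsbigE (index_enum _)) ?index_enum_uniq //; last first.
  by move=> m _; rewrite mem_index_enum.
under eq_bigl do rewrite in_setT.
rewrite (eq_bigr _ (fun m _ => PB m)).
rewrite -ge0_sume_distrr //.
(* At each [t], the number of [m] with [B m] is the number of outliers in one grid of [N] points. *)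
have sumB : (\sum_m P (B m) <= (eps * N)%:E)%E.
  apply: sum_prob_le => [m|t]; first exact: mV.
  pose f (c : {ffun 'I_d -> 'I_k.+1}) :=
    omega (fun s => V (fun=> ord0) t s (c s)).
  have := card_outliers f (ltW heps); congr (_%:R <= _).
  by apply: eq_card => m; rewrite !inE; apply/idP/idP => [?|/set_mem];
    rewrite ?mem_set.
apply: le_trans (lee_wpmul2l _ sumB) _; first by rewrite lee_fin invr_ge0 ltW.
by rewrite -EFinM lee_fin mulrC mulfK // gt_eqF.
Qed.
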